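(* Let $X$ be a nonnegative random variable with finite moments $m_k=\mathbf{E}[X^k]$, $k=1,2,\ldots$, such that $m_{k+1}/m_k\ge C(k+1)^{2+\varepsilon}$ for all large $k$, where $C$ and $\varepsilon$ are positive constants. Assume further that $X$ has a density $f$ satisfying the following condition: for some $x_0>0$, $f$ is positive and differentiable on $[x_0,\infty)$ and the function $$L_f(x):=-\frac{x f'(x)}{f(x)}$$ is monotonically increasing in $x$ for $x>x_0$ with $L_f(x)\to\infty$ as $x\to\infty$. Then $X$ is M-indet.
   Context: A nonnegative random variable with all moments finite is called M-det (moment determinate, in the sense of the Stieltjes moment problem) if its distribution is the only probability distribution on $[0,\infty)$ having its moment sequence; otherwise it is called M-indet (moment indeterminate), i.e., there is a different probability distribution on $[0,\infty)$ with the same moments. *)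

(* Defs.v *)
From HB Require Import structures.
From mathcomp Require Import all_boot all_order all_algebra.
From mathcomp Require Import all_classical all_reals all_analysis.

Set Implicit Arguments.
Unset Strict Implicit.
Unset Printing Implicit Defensive.

Import Order.TTheory GRing.Theory Num.Theory.
Import numFieldNormedType.Exports.

Local Open Scope classical_set_scope.
Local Open Scope ring_scope.

Definition moment (d : measure_display) (T : measurableType d) (R : realType)
    (P : probability T R) (X : T -> R) (k : nat) : \bar R :=
  'E_P[(fun t => X t ^+ k)].

(* nu is a probability distribution on [0, +oo[, viewed as a Borel
   probability on the whole line, with the same moments as X. *)
Definition same_moments (d : measure_display) (T : measurableType d)
    (R : realType) (P : probability T R) (X : {RV P >-> R})
    (nu : probability (measurableTypeR R) R) : Prop :=
  nu `[0, +oo[%classic = 1%E /\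
  forall k : nat, (\int[nu]_x (x ^+ k)%:E)%E = moment P X k.

(* Moment determinacy in the Stieltjes sense.  Both predicates are meant for
   an X that is nonnegative with all moments finite. *)
Definition M_det (d : measure_display) (T : measurableType d) (R : realType)
    (P : probability T R) (X : {RV P >-> R}) : Prop :=
  forall nu : probability (measurableTypeR R) R, same_moments X nu ->
  forall A : set (measurableTypeR R), measurable A -> nu A = distribution P X A.

Definition M_indet (d : measure_display) (T : measurableType d) (R : realType)
    (P : probability T R) (X : {RV P >-> R}) : Prop :=
  exists nu : probability (measurableTypeR R) R, same_moments X nu /\
  exists A : set (measurableTypeR R),
    measurable A /\ nu A <> distribution P X A.

Lemma M_indetE (d : measure_display) (T : measurableType d) (R : realType)
    (P : probability T R) (X : {RV P >-> R}) : M_indet X <-> ~ M_det X.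
Proof.
split=> [[nu [nuX [A [mA nuA]]]] det|]; first exact: nuA (det nu nuX A mA).
move=> ndet; apply: contrapT => nind; apply: ndet => nu nuX A mA.
by apply: contrapT => nuA; apply: nind; exists nu; split=> //; exists A.
Qed.

Definition has_density (d : measure_display) (T : measurableType d)
    (R : realType) (P : probability T R) (X : {RV P >-> R}) (f : R -> R) :=
  [/\ measurable_fun [set: measurableTypeR R] f,
      forall x, 0 <= f x &
      forall A : set (measurableTypeR R), measurable A ->
        distribution P X A = (\int[lebesgue_measure]_(x in A) (f x)%:E)%E].

(* Differentiability on [x0, +oo[: one-sided at the endpoint x0. *)
Definition derivable_cy (R : realType) (f : R -> R) (x0 : R) : Prop :=
  cvg (h^-1 * (f (x0 + h) - f x0) @[h --> 0^'+]) /\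
  forall x, x0 < x -> derivable f x 1.

Definition L_ (R : realType) (f : R -> R) (x : R) : R :=
  - (x * derive1 f x / f x).

(* Main.v *)
Require Import Defs.
From HB Require Import structures.
From mathcomp Require Import all_boot all_order all_algebra.
From mathcomp Require Import all_classical all_reals all_analysis measurable_realfun.
From mathcomp Require Import ring lra.

Set Implicit Arguments.
Unset Strict Implicit.
Unset Printing Implicit Defensive.

Import Order.TTheory GRing.Theory Num.Theory.
Import numFieldNormedType.Exports.

Local Open Scope classical_set_scope.
Local Open Scope ring_scope.

(** If the density satisfies f x >= k exp (- b x^al) for large x, with an
    exponent al < 1/2, then f leaves room for a nonzero perturbation
    all of whose moments vanish, and X is M-indet. So the proof bounds f from
    below, and then exhibits the perturbation.

    Lower bound. If L_ f y >= k + 3, then x^(k+3) f x decreases for x >= y; then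
    the moment of order k + 1 is carried by [0, 2 y] up to a constant factor,
    and exceeds the moment of order k by a factor of at most 4 y
    ([moment_succ_le]). Since it does so by a factor of at least
    C (k + 1)^(2 + eps), L_ f y is at most of order y^al, with
    al = 1 / (2 + eps) < 1/2 ([elasticity_le_powR]). As L_ f x / x is minus the
    derivative of ln f, integrating gives the lower bound on f
    ([density_lower_bound]).

    Perturbation. With r = x - c, it is Stieltjes' function
      exp (- a cos (pi al) r^al) sin (a sin (pi al) r^al),
    which is, up to sign, the imaginary part of exp (- a z^al) on the ray
    z = r e^(i pi). Rotating the half-line of integration of z^n exp (- a z^al)
    from angle 0 to angle pi does not change the integral, because
    al pi < pi / 2 makes the contribution of the arc at infinity vanish; the
    integral is real at angle 0, so its imaginary part at angle pi is 0
    ([stieltjes_moments0]). The rotation is carried out in real variables: the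
    truncated integral is differentiated in the angle, and its derivative is
    the flux through the outer end ([damped_sine_integral_le]). Starting the
    function at a large c rather than at 0 avoids the region where nothing is
    known of f, and keeps all moments zero ([shifted_moments0]).

    Adding a small multiple of the perturbation to f gives the density of a
    second distribution with the same moments ([M_indet_of_perturbation]). *)

(** * Stieltjes' damped sine and rotation of the half-line *)

Section contour_rotation.
Context {R : realType}.
Variables (al a c : R) (n : nat).
Hypotheses (al_gt0 : 0 < al) (a_gt0 : 0 < a).

(** With r = x - c and z = r e^(i theta), [wave] is the imaginary part of
    e^(i theta) z^n exp(- a z^al), and [flux] is the real part of
    r e^(i theta) z^n exp(- a z^al). *)
Let damp (theta x : R) : R := expR (- ((x - c) `^ al * (a * cos (al * theta)))).
Let phase (theta x : R) : R :=
  n.+1%:R * theta - (x - c) `^ al * (a * sin (al * theta)).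
Let wave (theta x : R) : R := (x - c) ^+ n * (damp theta x * sin (phase theta x)).
Let flux (theta x : R) : R :=
  (x - c) ^+ n.+1 * (damp theta x * cos (phase theta x)).

(** By analyticity, the derivative of [wave] in theta and that of [flux] in x
    are one and the same function. *)
Let dwave (theta x : R) : R := (x - c) ^+ n * damp theta x *
  (al * a * (x - c) `^ al * (sin (al * theta) * sin (phase theta x)
     - cos (al * theta) * cos (phase theta x)) + n.+1%:R * cos (phase theta x)).

Let is_derive_wave (theta x : R) : is_derive theta 1 (wave ^~ x) (dwave theta x).
Proof.
rewrite /wave /damp /phase; apply: is_derive_eq.
by rewrite /dwave /damp /phase /GRing.scale /=; ring.
Qed.

Lemma is_derive_powR_shift (x : R) : c < x ->
  is_derive x 1 (fun y : R => (y - c) `^ al) (al * (x - c) `^ (al - 1)).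
Proof.
move=> cx.
have cx0 : 0 < x - c by rewrite subr_gt0.
have h : is_derive x 1 (fun y : R => y - c) 1.
  by apply: is_derive_eq; rewrite subr0.
have := @is_derive1_comp R (fun y : R => y `^ al) (fun y => y - c) x _ _
  (is_derive1_powR al cx0) h.
by rewrite /comp mulr1.
Qed.

Let is_derive_flux (theta x : R) : c < x ->
  is_derive x 1 (flux theta) (dwave theta x).
Proof.
move=> cx.
have cx0 : 0 < x - c by rewrite subr_gt0.
have hp := is_derive_powR_shift cx.
have h : is_derive x 1 (fun y : R => y - c) 1.
  by apply: is_derive_eq; rewrite subr0.
have hX : is_derive x 1 (fun y : R => (y - c) ^+ n.+1) (n.+1%:R * (x - c) ^+ n).
  have := is_deriveX n.+1 h.
  by rewrite exprfctE /= /GRing.scale /= mulr1.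
have aux (u : R -> R) (du k m s : R) : is_derive x 1 u du ->
    is_derive x 1
      (fun y : R => (y - c) ^+ n.+1 * (expR (- (u y * k)) * cos (m - u y * s)))
      ((x - c) ^+ n * expR (- (u x * k)) * (n.+1%:R * cos (m - u x * s)
        + (x - c) * du * (s * sin (m - u x * s) - k * cos (m - u x * s)))).
  move=> hu; apply: is_derive_eq.
  by rewrite /GRing.scale /= exprS; ring.
have := aux _ _ (a * cos (al * theta)) (n.+1%:R * theta)
  (a * sin (al * theta)) hp.
move=> /is_derive_eq; apply.
have -> : (x - c) * (al * (x - c) `^ (al - 1)) = al * (x - c) `^ al.
  by rewrite mulrCA mulr_powRB1// ltW.
by rewrite /dwave /damp /phase; ring.
Qed.

(** The left endpoint needs its own argument, since y `^ al jumps to 1 when y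
    becomes negative. *)
Lemma continuous_powR_shift :
  {within `[c, +oo[, continuous (fun x : R => (x - c) `^ al)}.
Proof.
apply/continuous_within_itvcyP; split.
  move=> x; rewrite in_itv/= andbT => cx.
  apply: differentiable_continuous; apply/derivable1_diffP.
  by have [] := is_derive_powR_shift cx.
rewrite subrr powR0 ?gt_eqF//.
have /cvgrPdist_le h := powR_cvg0 al_gt0.
apply/cvgrPdist_le => e e0.
have [r /= r0 hr] := h e e0.
exists r => //= x /= xr cx.
apply: hr; rewrite /= ?subr_gt0//.
by rewrite sub0r normrN distrC.
Qed.

Let continuous_damped (T : topologicalType) (u : T -> R) (k m s : R) :
  continuous u ->
  [/\ continuous (fun y => expR (- (u y * k))),
      continuous (fun y => sin (m - u y * s))
    & continuous (fun y => cos (m - u y * s))].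
Proof.
move=> cu.
have cl (p q : R) : continuous (fun y => p - u y * q).
  move=> y; apply: cvgB; first exact: cvg_cst.
  by apply: cvgM; [exact: cu|exact: cvg_cst].
split=> y.
- under eq_fun do rewrite -sub0r.
  by apply: (continuous_comp (cl 0 k y)); exact: continuous_expR.
- by apply: (continuous_comp (cl m s y)); exact: continuous_sin.
- by apply: (continuous_comp (cl m s y)); exact: continuous_cos.
Qed.

Let I := `[c, +oo[%classic.

Let continuous_factors (theta : R) :
  [/\ forall m, {within I, continuous (fun x => (x - c) ^+ m)},
      {within I, continuous (damp theta)},
      {within I, continuous (fun x => sin (phase theta x))}
    & {within I, continuous (fun x => cos (phase theta x))}].
Proof.
have [h1 h2 h3] := continuous_damped (a * cos (al * theta)) (n.+1%:R * theta)
  (a * sin (al * theta)) continuous_powR_shift.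
split=> // m; apply: continuous_subspaceT => x.
apply: (@continuous_comp _ _ _ (fun y : R => y - c) (fun y => y ^+ m)).
  by apply: cvgB; [exact: cvg_id|exact: cvg_cst].
exact: exprn_continuous.
Qed.

Let continuous_wave theta : {within I, continuous (wave theta)}.
Proof.
have [h1 h2 h3 h4] := continuous_factors theta.
by move=> x; apply: cvgM; [exact: h1|apply: cvgM; [exact: h2|exact: h3]].
Qed.

Let continuous_dwave theta : {within I, continuous (dwave theta)}.
Proof.
have [h1 h2 h3 h4] := continuous_factors theta.
have cst k : {within I, continuous (fun=> k : R)} by move=> x; exact: cvg_cst.
move=> x; rewrite /dwave; apply: cvgM.
  by apply: cvgM; [exact: h1|exact: h2].
apply: cvgD; last by apply: cvgM; [exact: cst|exact: h4].
apply: cvgM.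
  by apply: cvgM; [exact: cst|exact: continuous_powR_shift].
by apply: cvgB; (apply: cvgM; first exact: cst); [exact: h3|exact: h4].
Qed.

Let continuous_flux theta : {within I, continuous (flux theta)}.
Proof.
have [h1 h2 h3 h4] := continuous_factors theta.
move=> x; rewrite /flux; apply: cvgM; first exact: h1.
by apply: cvgM; [exact: h2|exact: h4].
Qed.

Local Notation mu := lebesgue_measure.
Variable b : R.
Hypothesis cb : c < b.

Let J theta := \int[mu]_(x in `[c, b]) wave theta x.

Let segI : `[c, b] `<=` I.
Proof. by move=> x; rewrite /I /= !in_itv/= => /andP[-> _]. Qed.

Let integral_dwave theta : \int[mu]_(x in `[c, b]) dwave theta x = flux theta b.
Proof.
have cB : {within `[c, b], continuous (flux theta)}.
  by apply: continuous_subspaceW segI _; exact: continuous_flux.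
rewrite /Rintegral (@continuous_FTC2 _ _ (flux theta)) //=.
- by rewrite [flux theta c]/flux subrr exprS !mul0r subr0.
- by apply: continuous_subspaceW segI _; exact: continuous_dwave.
- have /continuous_within_itvP := cB; move=> /(_ cb)[_ l r].
  split => // x; rewrite in_itv/= => /andP[cx _].
  by have [] := is_derive_flux theta cx.
- move=> x; rewrite in_itv/= => /andP[cx _].
  by rewrite derive1E; have [_ ->] := is_derive_flux theta cx.
Qed.

Let bound : R := (b - c) ^+ n * expR ((b - c) `^ al * a) *
  (2 * (al * a * (b - c) `^ al) + n.+1%:R).

Let dwave_bound theta x : `[c, b]%classic x -> `|dwave theta x| <= bound.
Proof.
rewrite /= in_itv/= => /andP[cx xb].
have u0 : 0 <= (x - c) `^ al by exact: powR_ge0.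
have a0 := ltW a_gt0; have bc0 : 0 <= b - c by rewrite subr_ge0 ltW.
have xc0 : 0 <= x - c by rewrite subr_ge0.
have ub : (x - c) `^ al <= (b - c) `^ al.
  by apply: ge0_ler_powR; rewrite ?nnegrE ?(ltW al_gt0)// lerB.
have cs t : `|cos t : R| <= 1 by exact: cos_max.
have sn t : `|sin t : R| <= 1 by exact: sin_max.
have aA t : `|(x - c) `^ al * (a * t)| = (x - c) `^ al * a * `|t|.
  by rewrite mulrA normrM (ger0_norm (mulr_ge0 u0 a0)).
rewrite /dwave normrM; apply: ler_pM => //.
  rewrite normrM; apply: ler_pM => //.
    by rewrite normrX lerXn2r ?nnegrE// ger0_norm// lerB.
  rewrite /damp ger0_norm ?expR_ge0// ler_expR.
  rewrite (le_trans (ler_norm _))// normrN aA.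
  rewrite (le_trans (ler_piMr _ (cs _)))// ?mulr_ge0//.
  by rewrite ler_wpM2r.
apply: (le_trans (ler_normD _ _)); apply: lerD; last first.
  by rewrite normrM ger0_norm// ler_piMr.
rewrite normrM mulrC ler_pM//.
  apply: (le_trans (ler_normB _ _)); rewrite !normrM.
  by rewrite (_ : 2 = 1 + 1)// lerD// mulr_ile1.
have aa0 : 0 <= al * a by rewrite mulr_ge0// ltW.
by rewrite ger0_norm ?mulr_ge0 ?ler_wpM2l// ltW.
Qed.

Let integrable_wave x : mu.-integrable `[c, b] (EFin \o wave x).
Proof.
apply: continuous_compact_integrable; first exact: segment_compact.
by apply: continuous_subspaceW segI _; exact: continuous_wave.
Qed.

(** The truncated integral varies with the angle only through the flux at its
    outer end: the flux vanishes at c. *)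
Let is_derive_J (theta : R) : is_derive theta 1 J (flux theta b).
Proof.
have Iab : `](theta - 1), (theta + 1)[%classic theta.
  by rewrite /= in_itv/= ltrBlDr !ltrDl ltr01.
have dA x y : derivable (wave^~ y) x 1 by have [] := is_derive_wave x y.
have d1A x y : partial1of2 wave x y = dwave x y.
  by rewrite partial1of2E; have [_ ->] := is_derive_wave x y.
have bound0 : 0 <= bound.
  apply: le_trans (normr_ge0 _) (@dwave_bound theta c _).
  by rewrite /= in_itv/= lexx ltW.
have mseg : measurable (`[c, b]%classic : set (measurableTypeR R)) by [].
have ibound : mu.-integrable `[c, b] (EFin \o (fun=> bound)).
  apply: continuous_compact_integrable; first exact: segment_compact.
  by apply: continuous_subspaceT => ?; exact: cvg_cst.
have d1_bound x y : `](theta - 1), (theta + 1)[%classic x -> `[c, b]%classic y ->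
   `|partial1of2 wave x y| <= bound.
  by move=> _ Hy; rewrite d1A; exact: dwave_bound.
have dJ := derivable_under_integral mseg Iab (fun x _ => integrable_wave x)
  (fun x y _ _ => dA x y) (fun=> bound0) ibound d1_bound.
have J' := differentiation_under_integral mseg Iab
  (fun x _ => integrable_wave x) (fun x y _ _ => dA x y)
  (fun=> bound0) ibound d1_bound.
apply: DeriveDef => //; rewrite -derive1E J' -integral_dwave.
by apply: eq_Rintegral => x _; exact: d1A.
Qed.

Hypothesis al_half : al < 2^-1.

(** This is where al < 1/2 enters: on the whole half-turn, al * theta stays
    below pi / 2, so the slowest decay is the one at theta = pi and it is still
    exponential in (b - c) `^ al. *)
Let flux_bound (theta : R) : theta \in `[0, pi] ->
  `|flux theta b| <=
    (b - c) ^+ n.+1 * expR (- ((b - c) `^ al * (a * cos (al * pi)))).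
Proof.
rewrite in_itv/= => /andP[t0 tpi].
have bc0 : 0 <= b - c by rewrite subr_ge0 ltW.
have alpi : al * pi <= pi.
  by rewrite ler_piMl ?pi_ge0// (le_trans (ltW al_half))// invf_le1 ?ler1n.
have at_ap : al * theta <= al * pi by rewrite ler_wpM2l// ltW.
rewrite /flux normrM normrX ger0_norm//.
rewrite ler_wpM2l ?exprn_ge0// normrM /damp ger0_norm ?expR_ge0//.
rewrite (le_trans (ler_piMr _ (cos_max _))) ?expR_ge0// ler_expR lerN2.
rewrite ler_wpM2l ?powR_ge0// ler_wpM2l ?(ltW a_gt0)//.
have al0 := ltW al_gt0.
rewrite leNgt ltr_cos ?in_itv/= -?leNgt//; apply/andP; split=> //.
- by rewrite mulr_ge0 ?pi_ge0.
- by rewrite mulr_ge0.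
- exact: le_trans alpi.
Qed.

(** At theta = 0 the wave is identically zero, at theta = pi it is, up to sign,
    the damped sine times a power; in between the truncated integral moves at
    a speed bounded by the outer flux. *)
Lemma damped_sine_integral_le : `|\int[mu]_(x in `[c, b]) ((x - c) ^+ n *
    (expR (- ((x - c) `^ al * (a * cos (al * pi)))) *
     sin ((x - c) `^ al * (a * sin (al * pi)))))|
  <= (b - c) ^+ n.+1 * expR (- ((b - c) `^ al * (a * cos (al * pi)))) * pi.
Proof.
have sinpi m x : sin (m.+1%:R * pi - x) = (-1) ^+ m * sin x :> R.
  elim: m => [|m IH].
    by rewrite mul1r expr0 mul1r sinB sinpi cospi mul0r sub0r mulN1r opprK.
  by rewrite -natr1 mulrDl mul1r addrAC sinDpi IH exprS mulN1r mulNr.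
have [k kI Jk] := @MVT _ J (flux ^~ b) 0 pi (@pi_gt0 R) (fun x _ => is_derive_J x)
  (derivable_within_continuous
    (fun x _ => @ex_derive _ _ _ _ _ _ _ (is_derive_J x))).
have J0 : J 0 = 0.
  rewrite /J /Rintegral integral0_eq// => x _.
  by rewrite /wave /phase !mulr0 sin0 !mulr0 subr0 sin0 !mulr0.
have -> : \int[mu]_(x in `[c, b]) ((x - c) ^+ n *
    (expR (- ((x - c) `^ al * (a * cos (al * pi)))) *
     sin ((x - c) `^ al * (a * sin (al * pi))))) = (-1) ^+ n * J pi.
  rewrite /J -RintegralZl//; apply: eq_Rintegral => x _.
  by rewrite /wave /phase /damp sinpi 3!(mulrCA ((-1) ^+ n)) signrMK.
rewrite normrMsign -[J pi]subr0 -J0 Jk subr0 normrM (ger0_norm (pi_ge0 R)).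
by rewrite ler_wpM2r ?pi_ge0// flux_bound// subset_itv_oo_cc.
Qed.

End contour_rotation.

Lemma powX_expRN_le (R : realType) (al g : R) (k : nat) : 0 < al -> 0 < g ->
  exists K : R, forall x, 1 <= x -> x ^+ k * expR (- (x `^ al * g)) <= K / x.
Proof.
move=> al0 g0.
pose N := Num.bound (k.+1%:R / al).
have N1 : k.+1%:R <= al * N.+1%:R.
  rewrite -ler_pdivrMl// mulrC.
  have /ltW/le_trans := archi_boundP (divr_ge0 (ler0n R k.+1) (ltW al0)); apply.
  by rewrite ler_nat.
(* A power of x `^ al reaches x ^+ k.+1 once its exponent N.+1 is at least
   k.+1 / al, and the exponential dominates that power. *)
exists (N.+1`!%:R / g ^+ N.+1) => x x1.
have x0 : 0 < x by exact: lt_le_trans x1.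
have t0 : 0 <= x `^ al * g by rewrite mulr_ge0 ?powR_ge0// ltW.
rewrite expRN ler_pdivrMr ?expR_gt0//.
have h : (x `^ al * g) ^+ N.+1 / N.+1`!%:R <= expR (x `^ al * g).
  by apply: le_trans (expR_ge1Dxn N t0); rewrite lerDr.
have gN : 0 < g ^+ N.+1 by rewrite exprn_gt0.
have fN : 0 < N.+1`!%:R :> R by rewrite ltr0n fact_gt0.
apply: (@le_trans _ _ (N.+1`!%:R / g ^+ N.+1 / x *
    ((x `^ al * g) ^+ N.+1 / N.+1`!%:R))).
  rewrite exprMn -(powR_mulrn _ (powR_ge0 x al)) -powRrM.
  have -> : N.+1`!%:R / g ^+ N.+1 / x *
      (x `^ (al * N.+1%:R) * g ^+ N.+1 / N.+1`!%:R) = x `^ (al * N.+1%:R) / x.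
    by field; rewrite !gt_eqF.
  rewrite ler_pdivlMr// -exprSr -powR_mulrn ?(ltW x0)//.
  exact: ler_powR.
by rewrite ler_wpM2l// !mulr_ge0 ?invr_ge0 ?ltW.
Qed.

Lemma cvg_integral_exhaustion d (T : measurableType d) (R : realType)
    (mu : {measure set T -> \bar R}) (D : set T) (S : (set T)^nat)
    (h : T -> \bar R) :
  measurable D -> (forall m, measurable (S m)) -> (forall m, S m `<=` D) ->
  (forall x, D x -> \forall m \near \oo, S m x) ->
  mu.-integrable D h ->
  (\int[mu]_(x in S m) h x)%E @[m --> \oo] --> (\int[mu]_(x in D) h x)%E.
Proof.
move=> mD mS SD DS ih.
have SI m : S m `&` D = S m by exact/setIidPl.
have mh := measurable_int _ ih.
under eq_fun do rewrite -SI setIC integral_mkcondr.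
have := @dominated_convergence _ T R mu D mD (fun m => h \_ (S m)) h
  (fun x => `|h x|%E) _ mh _ (integrable_abse ih) _; case=> //.
- move=> m; apply/measurable_restrict => //.
  by rewrite setIC SI; apply: measurable_funS mh => //; exact: SD.
- apply: aeW => x Dx; apply: cvg_near_cst.
  near=> m; rewrite patchE mem_set//.
  by near: m; exact: DS.
- apply: aeW => x m _; rewrite patchE; case: ifPn => // _.
  by rewrite abse0.
Unshelve. all: by end_near. Qed.

Lemma cvg_Rintegral_cy (R : realType) (h : R -> R) (c : R) :
  lebesgue_measure.-integrable `[c, +oo[ (EFin \o h) ->
  \int[lebesgue_measure]_(x in `[c, c + m.+1%:R]) h x @[m --> \oo] -->
  \int[lebesgue_measure]_(x in `[c, +oo[) h x.
Proof.
move=> ih; rewrite /Rintegral; apply: fine_cvg; rewrite fineK; last first.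
  exact: integrable_fin_num.
apply: (@cvg_integral_exhaustion _ (measurableTypeR R) R lebesgue_measure
  `[c, +oo[%classic (fun m => `[c, c + m.+1%:R]%classic) (EFin \o h)) => //.
- by move=> m x /=; rewrite !in_itv/= => /andP[->].
- move=> x /=; rewrite in_itv/= andbT => cx.
  near=> m; rewrite /= in_itv/= cx/=.
  rewrite -lerBlDl (@le_trans _ _ m%:R)// ?ler_nat//.
  by near: m; exact: nbhs_infty_ger.
Unshelve. all: by end_near. Qed.

(** Stieltjes' signed density, moved to start at c: the damping outweighs any
    power of x, so the bound on the truncated integrals tends to zero. *)
Lemma stieltjes_moments0 (R : realType) (al a c : R) (n : nat) :
  0 < al -> al < 2^-1 -> 0 < a ->
  let g x := expR (- ((x - c) `^ al * (a * cos (al * pi)))) *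
             sin ((x - c) `^ al * (a * sin (al * pi))) in
  lebesgue_measure.-integrable `[c, +oo[ (fun x => ((x - c) ^+ n * g x)%:E) ->
  \int[lebesgue_measure]_(x in `[c, +oo[) ((x - c) ^+ n * g x) = 0.
Proof.
move=> al0 al2 a0 g ig.
have cospos : 0 < a * cos (al * pi).
  rewrite mulr_gt0// cos_gt0_pihalf//.
  rewrite (@lt_trans _ _ 0) ?oppr_lt0 ?divr_gt0 ?mulr_gt0 ?pi_gt0//=.
  by rewrite mulrC ltr_pM2l ?pi_gt0.
have [K hK] := powX_expRN_le n.+1 al0 cospos.
rewrite -(cvg_lim (@Rhausdorff R) (cvg_Rintegral_cy ig)).
apply: (cvg_lim (@Rhausdorff R)); apply: norm_cvg0.
apply: (@squeeze_cvgr _ _ _ _ (cst 0) (fun m => K * pi * harmonic m)).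
- near=> m; rewrite normr_ge0/=.
  have cm : c < c + m.+1%:R by rewrite ltrDl.
  apply: le_trans (damped_sine_integral_le n al0 a0 cm al2) _.
  rewrite addrAC subrr add0r [leRHS]mulrAC ler_wpM2r ?pi_ge0//.
  by apply: hK; rewrite ler1n.
- exact: cvg_cst.
- rewrite -[X in _ --> X](mulr0 (K * pi)); apply: cvgM; first exact: cvg_cst.
  exact: cvg_harmonic.
Unshelve. all: by end_near. Qed.

(** * Ratio of consecutive moments *)

Section inv_sqr.
Context {R : realType}.
Variable A : R.
Let F (x : R) := - (A * x^-1).

Let is_derive_F (x : R) : 0 < x -> is_derive x 1 F (A * x ^- 2).
Proof.
move=> x0; have hV := is_deriveV (lt0r_neq0 x0) (is_derive_id x (1 : R)).
rewrite /F; apply: is_derive_eq.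
by rewrite /GRing.scale/= mulr1 mulrN opprK.
Qed.

Let continuous_F (x : R) : 0 < x -> {for x, continuous F}.
Proof.
move=> /is_derive_F[dF _]; apply: differentiable_continuous.
exact/derivable1_diffP.
Qed.

Lemma continuous_sqrV (x : R) : 0 < x ->
  {for x, continuous (fun x : R => A * x ^- 2)}.
Proof.
move=> x0; apply: cvgM; first exact: cvg_cst.
apply: cvgV; first by rewrite expf_neq0// gt_eqF.
exact: exprn_continuous.
Qed.

Lemma integral_sqrV_itv (y z : R) : 0 < y -> y < z ->
  (\int[lebesgue_measure]_(x in `[y, z]) (A * x ^- 2)%:E =
    (A / y - A / z)%:E)%E.
Proof.
move=> y0 yz; have z0 : 0 < z by exact: lt_trans yz.
rewrite (@continuous_FTC2 _ _ F)//.
- by rewrite -EFinB /F opprK addrC.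
- apply: continuous_in_subspaceT => x; rewrite inE/= in_itv/= => /andP[yx _].
  by apply: continuous_sqrV; exact: lt_le_trans yx.
- split.
  + move=> x; rewrite in_itv/= => /andP[yx _].
    by have [] := is_derive_F (lt_trans y0 yx).
  + by apply: cvg_at_right_filter; exact: continuous_F.
  + by apply: cvg_at_left_filter; exact: continuous_F.
- move=> x; rewrite in_itv/= => /andP[yx _].
  by rewrite derive1E; have [_ ->] := is_derive_F (lt_trans y0 yx).
Qed.

Lemma integral_sqrV_cy (z : R) : 0 <= A -> 0 < z ->
  (\int[lebesgue_measure]_(x in `[z, +oo[) (A * x ^- 2)%:E = (A / z)%:E)%E.
Proof.
move=> A0 z0.
rewrite (@ge0_continuous_FTC2y _ _ F _ 0)//.
- by rewrite /F EFinN oppeK add0e.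
- by move=> x zx; rewrite mulr_ge0// invr_ge0 exprn_ge0// (le_trans (ltW z0)).
- apply: continuous_in_subspaceT => x; rewrite inE/= in_itv/= andbT => zx.
  by apply: continuous_sqrV; exact: lt_le_trans zx.
- rewrite -oppr0 -[X in - X](mulr0 A); apply: cvgN.
  apply: cvgM; first exact: cvg_cst.
  apply/gtr0_cvgV0; last exact: cvg_id.
  exact: nbhs_pinfty_gt.
- by move=> x zx; have [] := is_derive_F (lt_trans z0 zx).
- by apply: cvg_at_right_filter; exact: continuous_F.
- move=> x; rewrite in_itv/= andbT => zx.
  by rewrite derive1E; have [_ ->] := is_derive_F (lt_trans z0 zx).
Qed.

End inv_sqr.

(** With z = 2 y, the part of the (k+1)-st moment below z costs a factor z.
    Beyond z, the monotonicity of x ^+ k.+3 * f x gives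
    x ^+ k.+1 * f x <= A / x ^+ 2 with A = z ^+ k.+3 * f z, and the opposite
    inequality on [y, z]; since 1 / x ^+ 2 has the same integral over [y, 2 y]
    and over [2 y, +oo[, the tail is at most the integral over [y, z], which
    again costs a factor z. *)
Lemma moment_succ_le (R : realType) (f : R -> R) (k : nat) (y : R) :
  measurable_fun [set: measurableTypeR R] f -> (forall x, 0 <= f x) -> 0 < y ->
  (forall u v, y <= u -> u <= v -> v ^+ k.+3 * f v <= u ^+ k.+3 * f u) ->
  (\int[lebesgue_measure]_(x in `[0%R, +oo[) (x ^+ k.+1 * f x)%:E <=
   (4 * y)%:E * \int[lebesgue_measure]_(x in `[0%R, +oo[) (x ^+ k * f x)%:E)%E.
Proof.
move=> mf f0 y0 hdec; set z := 2 * y; set M := (X in (_ <= _ * X)%E).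
have yz : y < z by rewrite /z mulr_natl mulr2n ltrDr.
have z0 : 0 < z by exact: lt_trans yz.
have mX j (D : set (measurableTypeR R)) :
    measurable_fun D (fun x : R => (x ^+ j * f x)%:E).
  apply/measurable_EFinP; apply: measurable_funTS.
  by apply: measurable_funM => //; exact: measurable_funX.
have mV (D : set (measurableTypeR R)) (A : R) : measurable D ->
    D `<=` `]0, +oo[%classic -> measurable_fun D (fun x : R => (A * x ^- 2)%:E).
  move=> mD D0; apply/measurable_EFinP.
  apply: (@measurable_funS _ _ (measurableTypeR R) _ `]0, +oo[%classic) => //.
  apply: open_continuous_measurable_fun => //.
  by move=> x; rewrite inE/= in_itv/= andbT; exact: continuous_sqrV.
have X0 j (D : set R) : D `<=` `[0, +oo[ ->
    forall x, D x -> (0 <= (x ^+ j * f x)%:E)%E.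
  move=> D0 x /D0 /=; rewrite in_itv/= andbT => x0.
  by rewrite lee_fin mulr_ge0// exprn_ge0.
have zM (D : set R) : measurable (D : set (measurableTypeR R)) ->
    D `<=` `[0, z] ->
    (\int[lebesgue_measure]_(x in D) (x ^+ k.+1 * f x)%:E <= z%:E * M)%E.
  move=> mD Dz.
  have D0 : D `<=` `[0, +oo[.
    by move=> x /Dz /=; rewrite !in_itv/= => /andP[->].
  apply: (@le_trans _ _
      (\int[lebesgue_measure]_(x in D) (z%:E * (x ^+ k * f x)%:E))%E).
    apply: ge0_le_integral => //.
    - exact: X0.
    - by apply: emeasurable_funM => //; exact: mX.
    - move=> x Dx; have := X0 k _ D0 x Dx; rewrite -EFinM !lee_fin => h.
      rewrite exprS -mulrA ler_wpM2r//.
      by move: (Dz x Dx); rewrite /= in_itv/= => /andP[].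
  rewrite ge0_integralZl//; last 2 first.
  - exact: X0.
  - by rewrite lee_fin ltW.
  rewrite lee_wpmul2l ?lee_fin ?(ltW z0)//.
  by apply: ge0_subset_integral => //; exact: X0.
have -> : `[0, +oo[%classic = `[0, z[%classic `|` `[z, +oo[%classic :> set R.
  by rewrite -itv_bndbnd_setU// bnd_simp ltW.
rewrite ge0_integral_setU//=; last 2 first.
- apply: (X0 _ (`[0, z[ `|` `[z, +oo[)).
  by rewrite -itv_bndbnd_setU// bnd_simp ltW.
- apply/disj_setPS => x /=; rewrite !in_itv/= andbT => -[/andP[_ xz]].
  by move=> /(lt_le_trans xz); rewrite ltxx.
have -> : (4 * y)%:E = (z%:E + z%:E)%E.
  by rewrite -EFinD; congr EFin; rewrite /z; ring.
rewrite ge0_muleDl ?lee_fin ?(ltW z0)//; apply: leeD.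
  apply: zM => // x /=; rewrite !in_itv/= => /andP[-> /ltW->//].
apply: (@le_trans _ _
    (\int[lebesgue_measure]_(x in `[y, z]) (x ^+ k.+1 * f x)%:E)%E); last first.
  apply: zM => // x /=; rewrite !in_itv/= => /andP[/(le_trans (ltW y0))-> ->//].
pose A := z ^+ k.+3 * f z.
have A0 : 0 <= A by rewrite mulr_ge0// exprn_ge0// ltW.
apply: (@le_trans _ _ (A / z)%:E).
  rewrite -(integral_sqrV_cy A0 z0); apply: ge0_le_integral => //.
  - apply: X0 => x /=; rewrite !in_itv/= !andbT; exact: le_trans (ltW z0).
  - by apply: mV => // x /=; rewrite !in_itv/= !andbT; exact: lt_le_trans z0.
  - move=> x /=; rewrite in_itv/= andbT => zx.
    have x0 : 0 < x := lt_le_trans z0 zx.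
    rewrite lee_fin ler_pdivlMr ?exprn_gt0// mulrAC -exprD addn2.
    exact: hdec (ltW yz) zx.
have <- : A / y - A / z = A / z.
  by rewrite /z; field; rewrite gt_eqF.
rewrite -(integral_sqrV_itv A y0 yz); apply: ge0_le_integral => //.
- by move=> x _; rewrite lee_fin mulr_ge0// invr_ge0 sqr_ge0.
- apply: mV => // x /=; rewrite !in_itv/= => /andP[yx _].
  by rewrite (lt_le_trans y0 yx).
- move=> x /=; rewrite in_itv/= => /andP[yx xz].
  have x0 : 0 < x := lt_le_trans y0 yx.
  rewrite lee_fin ler_pdivrMr ?exprn_gt0// mulrAC -exprD addn2.
  exact: hdec yx xz.
Qed.

(** * From moment growth to a lower bound on the density *)

Section elasticity.
Context {R : realType}.
Variables (f : R -> R) (x0 : R).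
Hypotheses (x0_gt0 : 0 < x0) (f_gt0 : forall x, x0 <= x -> 0 < f x)
  (df : forall x, x0 < x -> derivable f x 1).

Let is_derive_f (x : R) : x0 < x -> is_derive x 1 f (derive1 f x).
Proof. by move=> xx; rewrite derive1E; apply: DeriveDef => //; exact: df. Qed.

Let derive_L (x : R) : x0 < x -> derive1 f x = - (L_ f x * f x / x).
Proof.
move=> xx; have fx : f x != 0 by rewrite gt_eqF// f_gt0// ltW.
have x_neq0 : x != 0 by rewrite gt_eqF// (lt_trans x0_gt0).
by rewrite /L_; field; rewrite fx x_neq0.
Qed.

(** The logarithmic derivative of x ^+ K * f x is (K - L_ f x) / x. *)
Lemma expr_density_nonincreasing (y : R) (K : nat) : x0 < y ->
  (forall x, y <= x -> K%:R <= L_ f x) ->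
  forall u v, y <= u -> u <= v -> v ^+ K * f v <= u ^+ K * f u.
Proof.
move=> x0y LK.
pose h x := x ^+ K * f x.
have dh x : x0 < x -> is_derive x 1 h (x ^+ K * f x * ((K%:R - L_ f x) / x)).
  move=> xx; have hf := is_derive_f xx.
  have hX : is_derive x 1 (fun x : R => x ^+ K) (K%:R * x ^+ K.-1).
    have := is_deriveX K (is_derive_id x (1 : R)).
    by rewrite exprfctE /= /GRing.scale /= mulr1.
  rewrite /h; apply: is_derive_eq.
  have x_neq0 : x != 0 by rewrite gt_eqF// (lt_trans x0_gt0).
  rewrite derive_L// /GRing.scale/=.
  case: K {LK h hX} => [|K].
    by rewrite !expr0 /=; field.
  by rewrite exprS /=; field.
move=> u v; apply: (@ler0_derive1_nincry _ h y).
- by move=> x; rewrite in_itv/= andbT => yx; have [] := dh _ (lt_trans x0y yx).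
- move=> x; rewrite in_itv/= andbT => yx.
  have xx0 := lt_trans x0y yx; have x0' := lt_trans x0_gt0 xx0.
  rewrite derive1E; have [_ ->] := dh _ xx0.
  rewrite mulr_ge0_le0//.
    by rewrite mulr_ge0 ?exprn_ge0 ?(ltW x0')// ltW// f_gt0// ltW.
  by rewrite mulr_le0_ge0 ?invr_ge0 ?(ltW x0')// subr_le0 LK// ltW.
- apply: continuous_in_subspaceT => x; rewrite inE/= in_itv/= andbT => yx.
  apply: differentiable_continuous; apply/derivable1_diffP.
  by have [] := dh _ (lt_le_trans x0y yx).
Qed.

(** The function f x * expR (B / al * x `^ al) has logarithmic derivative
    (B * x `^ al - L_ f x) / x, hence does not decrease. *)
Lemma density_lower_bound (x1 B al : R) : x0 < x1 -> 0 < al ->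
  (forall x, x1 <= x -> L_ f x <= B * x `^ al) ->
  exists2 k : R, 0 < k &
    forall x, x1 <= x -> k * expR (- (x `^ al * (B / al))) <= f x.
Proof.
move=> x01 al0 LB.
pose h x := f x * expR (x `^ al * (B / al)).
have dh x : x0 < x -> is_derive x 1 h (h x * ((B * x `^ al - L_ f x) / x)).
  move=> xx; have hf := is_derive_f xx.
  have x_gt0 := lt_trans x0_gt0 xx.
  have hp := is_derive1_powR al x_gt0.
  rewrite /h; apply: is_derive_eq.
  rewrite derive_L// /GRing.scale/= -(mulr_powRB1 (ltW x_gt0) al0).
  by field; rewrite !gt_eqF.
exists (h x1); first by rewrite mulr_gt0 ?expR_gt0// f_gt0// ltW.
move=> x xx1; rewrite expRN ler_pdivrMr ?expR_gt0//.
apply: (@ger0_derive1_ndecry _ h x1) => //.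
- by move=> z; rewrite in_itv/= andbT => yx; have [] := dh _ (lt_trans x01 yx).
- move=> z; rewrite in_itv/= andbT => yx.
  have xx0 := lt_trans x01 yx; have x0' := lt_trans x0_gt0 xx0.
  rewrite derive1E; have [_ ->] := dh _ xx0.
  rewrite mulr_ge0//.
    by rewrite mulr_ge0 ?expR_ge0// ltW// f_gt0// ltW.
  by rewrite mulr_ge0 ?invr_ge0 ?(ltW x0')// subr_ge0 LB// ltW.
- apply: continuous_in_subspaceT => z; rewrite inE/= in_itv/= andbT => yx.
  apply: differentiable_continuous; apply/derivable1_diffP.
  by have [] := dh _ (lt_le_trans x01 yx).
Qed.

End elasticity.

(** If L_ f x >= k + 3, the ratio of the moments of orders k + 1 and k is at
    most 4 x, so the growth hypothesis forces
    C (k + 1)^(2 + eps) <= 4 x; applied to the largest such k, this bounds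
    L_ f x itself. *)
Lemma elasticity_le_powR (R : realType) (f : R -> R) (x0 C eps : R)
    (M := fun k : nat =>
       (\int[lebesgue_measure]_(x in `[0%R, +oo[) (x ^+ k * f x)%:E)%E) :
  0 < C -> 0 < eps -> 0 < x0 ->
  measurable_fun [set: measurableTypeR R] f -> (forall x, 0 <= f x) ->
  (forall x, x0 <= x -> 0 < f x) -> (forall x, x0 < x -> derivable f x 1) ->
  (forall x y, x0 < x -> x <= y -> L_ f x <= L_ f y) ->
  L_ f x @[x --> +oo] --> +oo ->
  (forall k, M k \is a fin_num) ->
  (\forall k \near \oo,
    C * k.+1%:R `^ (2 + eps) <= fine (M k.+1) / fine (M k)) ->
  exists B x1 : R, x0 < x1 /\
    forall x, x1 <= x -> L_ f x <= B * x `^ (2 + eps)^-1.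
Proof.
move=> C0 eps0 x0_gt0 mf f0 f_gt0 df L_incr L_cvg Mfin [k0 _ growth].
have e2 : 0 < 2 + eps by rewrite addr_gt0.
have /cvgryPge/(_ k0.+3%:R)[X [_ hX]] := L_cvg.
(* The outer 4 comes from L_ f x < k + 4 <= 4 (k + 1). *)
exists (4 * (4 / C) `^ (2 + eps)^-1), (Num.max x0 X + 1).
split; first by rewrite ltr_pwDr// le_max lexx.
move=> x xX.
have x0x : x0 < x by apply: lt_le_trans xX; rewrite ltr_pwDr// le_max lexx.
have x_gt0 : 0 < x := lt_trans x0_gt0 x0x.
have Lx : k0.+3%:R <= L_ f x.
  by apply: hX; apply: lt_le_trans xX; rewrite ltr_pwDr// le_max lexx orbT.
have L0 : 0 <= L_ f x by apply: le_trans Lx.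
have /andP[tL Lt] := truncn_itv L0.
have : (k0.+3 <= Num.truncn (L_ f x))%N.
  by rewrite -ltnS -(ltr_nat R) (le_lt_trans Lx).
case: (Num.truncn (L_ f x)) tL Lt => [|[|[|k]]]// tL Lt k0k.
have Mk : fine (M k.+1) / fine (M k) <= 4 * x.
  have := moment_succ_le mf f0 x_gt0
    (expr_density_nonincreasing x0_gt0 f_gt0 df x0x
       (fun z xz => le_trans tL (L_incr _ _ x0x xz))).
  rewrite -/(M k) -/(M k.+1) -(fineK (Mfin k)) -(fineK (Mfin k.+1)).
  rewrite -EFinM lee_fin => hM.
  have : 0 <= fine (M k).
    apply: fine_ge0; apply: integral_ge0 => z /=; rewrite in_itv/= andbT => z0.
    by rewrite lee_fin mulr_ge0// exprn_ge0.
  rewrite le_eqVlt => /predU1P[<-|Mk0].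
    by rewrite invr0 mulr0 mulr_ge0// ltW.
  by rewrite ler_pdivrMr.
have hk : k.+1%:R <= (4 / C * x) `^ (2 + eps)^-1.
  have h : k.+1%:R `^ (2 + eps) <= 4 / C * x.
    rewrite mulrAC ler_pdivlMr// mulrC; exact: le_trans (growth k k0k) Mk.
  have -> : k.+1%:R = (k.+1%:R `^ (2 + eps)) `^ (2 + eps)^-1 :> R.
    by rewrite -powRrM divff ?lt0r_neq0// powRr1.
  apply: ge0_ler_powR; rewrite ?nnegrE ?powR_ge0 ?invr_ge0 ?(ltW e2)//.
  by rewrite !mulr_ge0 ?invr_ge0 ?(ltW C0) ?(ltW x_gt0).
apply: (@le_trans _ _ (4 * k.+1%:R)).
  rewrite (le_trans (ltW Lt))// -natrM ler_nat -addn4 addnC mulnS.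
  by rewrite leq_add2l leq_pmull.
rewrite -mulrA ler_wpM2l// -powRM ?(ltW x_gt0)//.
by rewrite mulr_ge0 ?invr_ge0 ?(ltW C0).
Qed.

(** * Distributions given by a density *)

Definition density_measure d (T : measurableType d) (R : realType)
    (mu : {measure set T -> \bar R}) (w : T -> R) (A : set T) : \bar R :=
  (\int[mu]_(x in A) (w x)%:E)%E.

Lemma density_probability d (T : measurableType d) (R : realType)
    (mu : {measure set T -> \bar R}) (w : T -> R) :
  measurable_fun [set: T] w -> (forall x, 0 <= w x) ->
  (\int[mu]_x (w x)%:E = 1)%E ->
  exists nu : probability T R, forall A, nu A = density_measure mu w A.
Proof.
move=> mw w0 w1.
have nu0 : density_measure mu w set0 = 0%E by exact: integral_set0.
have nu_ge0 A : (0 <= density_measure mu w A)%E.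
  by apply: integral_ge0 => x _; rewrite lee_fin.
have nu_sigma : semi_sigma_additive (density_measure mu w).
  move=> /= A mA tA mUA.
  rewrite /density_measure ge0_integral_bigcup//=.
  - by apply: is_cvg_ereal_nneg_natsum_cond => n _ _; exact: nu_ge0.
  - by apply/measurable_EFinP; exact: measurable_funTS.
  - by move=> x _; rewrite lee_fin.
pose M := isMeasure.Build _ _ _ (density_measure mu w) nu0 nu_ge0 nu_sigma.
pose nuM : {measure set T -> \bar R} := HB.pack (density_measure mu w) M.
pose Q := Measure_isProbability.Build _ _ _ nuM w1.
pose nuP : probability T R := HB.pack (density_measure mu w) M Q.
by exists nuP.
Qed.

(** By uniqueness of densities, w is almost everywhere the Radon-Nikodym
    derivative of nu. *)
Lemma integral_density_measure d (T : measurableType d) (R : realType)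
    (mu : {sigma_finite_measure set T -> \bar R}) (nu : probability T R)
    (w : T -> R) (phi : T -> \bar R) (D : set T) :
  measurable_fun [set: T] w -> (forall x, 0 <= w x) ->
  (forall A, measurable A -> nu A = density_measure mu w A) ->
  measurable D -> (forall x, 0 <= phi x)%E -> measurable_fun D phi ->
  (\int[nu]_(x in D) phi x = \int[mu]_(x in D) (phi x * (w x)%:E))%E.
Proof.
move=> mw w0 nuE mD phi0 mphi.
have mwE (A : set T) : measurable_fun A (EFin \o w).
  by apply/measurable_EFinP; exact: measurable_funTS.
have numu : nu `<< mu.
  apply/null_content_dominatesP => A mA muA0.
  by rewrite /= nuE// /density_measure null_set_integral.
rewrite -(Radon_Nikodym_SigmaFinite.change_of_variables numu)//.
have iRN := Radon_Nikodym_SigmaFinite.f_integrable numu.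
have mRN := measurable_int _ iRN.
apply: ae_eq_integral => //.
- by apply: emeasurable_funM => //; exact: measurable_funTS.
- exact: emeasurable_funM.
- apply: ae_eqe_mul2l; apply: integral_ae_eq => //.
  + exact: integrableS iRN.
  + move=> A AD mA.
    apply: etrans (nuE A mA).
    exact: esym (Radon_Nikodym_SigmaFinite.f_integral numu mA).
Qed.

Section moments_on_halfline.
Context {R : realType}.
Variable nu : probability (measurableTypeR R) R.
Hypothesis nu_pos : nu `[0, +oo[%classic = 1%E.

Let mD : measurable (`[0, +oo[%classic : set (measurableTypeR R)).
Proof. by []. Qed.

Let D_ae (Q : R -> Prop) : (forall x, 0 <= x -> Q x) -> {ae nu, forall x, Q x}.
Proof.
move=> DQ; exists (~` `[0, +oo[%classic); split; first exact: measurableC.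
- by rewrite /= probability_setC// nu_pos subee.
- by move=> x /= nQ; rewrite in_itv/= andbT => /DQ.
Qed.

(** Absolute values turn a moment into the integral of a nonnegative function,
    to which [integral_density_measure] applies. *)
Lemma integral_expr_norm k :
  (\int[nu]_x (x ^+ k)%:E = \int[nu]_x (`|x| ^+ k)%:E)%E.
Proof.
apply: ae_eq_integral => //.
- by apply/measurable_EFinP; exact: measurable_funX.
- by apply/measurable_EFinP; exact: measurable_funX.
- by apply: D_ae => x x0 _; rewrite ger0_norm.
Qed.

Lemma integral_expr_density (w : R -> R) k :
  measurable_fun [set: measurableTypeR R] w -> (forall x, 0 <= w x) ->
  (forall A, measurable A -> nu A = density_measure lebesgue_measure w A) ->
  (\int[nu]_x (`|x| ^+ k)%:E =
    \int[lebesgue_measure]_(x in `[0%R, +oo[) (x ^+ k * w x)%:E)%E.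
Proof.
move=> mw w0 nuE.
have mphi : measurable_fun [set: measurableTypeR R]
    (fun x : R => (`|x| ^+ k)%:E).
  by apply/measurable_EFinP; apply: measurable_funX.
transitivity (\int[nu]_(x in `[0%R, +oo[) (`|x| ^+ k)%:E)%E.
  rewrite [RHS]integral_mkcond; apply: ae_eq_integral => //.
  - apply/(measurable_restrict _ _ _).1 => //.
    by rewrite setTI; exact: measurable_funTS.
  - by apply: D_ae => x x0 _; rewrite patchE mem_set//= in_itv/= x0.
rewrite (integral_density_measure mw w0 nuE)//.
  apply: eq_integral => x; rewrite inE/= in_itv/= andbT => x0.
  by rewrite ger0_norm.
exact: measurable_funTS.
Qed.

End moments_on_halfline.

(** The real line carries two measurable structures with the same measurable
    sets but different displays; M_indet and Lebesgue measure use
    measurableTypeR, while X takes its values in the other one. *)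
Definition borel_rv d (T : measurableType d) (R : realType)
    (P : probability T R) (X : {RV P >-> R}) : {mfun T >-> measurableTypeR R} :=
  HB.pack (X : T -> measurableTypeR R)
    (isMeasurableFun.Build _ _ T (measurableTypeR R) X (measurable_funPT X)).

Lemma distribution_nneg d (T : measurableType d) (R : realType)
    (P : probability T R) (X : {RV P >-> R}) :
  {ae P, forall t, 0 <= X t} ->
  distribution P (borel_rv X) `[0, +oo[%classic = 1%E.
Proof.
move=> [N [mN PN0 XN]].
have mXD : measurable (X @^-1` `[0, +oo[%classic).
  by rewrite -[X in measurable X]setTI; exact: measurable_funP.
have PN : P (~` (X @^-1` `[0, +oo[%classic)) = 0%E.
  apply: (subset_measure0 _ mN _ PN0) => //; first exact: measurableC.
  move=> t /= Xt; apply: XN => /= X0; apply: Xt.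
  by rewrite in_itv/= X0.
rewrite /distribution /pushforward/= -[X in P X]setCK.
rewrite probability_setC ?PN ?sube0//.
exact: measurableC.
Qed.

Lemma moment_distribution d (T : measurableType d) (R : realType)
    (P : probability T R) (X : {RV P >-> R}) k :
  {ae P, forall t, 0 <= X t} ->
  moment P X k = (\int[distribution P (borel_rv X)]_x (`|x| ^+ k)%:E)%E.
Proof.
move=> [N [mN PN0 XN]].
rewrite ge0_integral_distribution//; last first.
  by apply/measurable_EFinP; apply: measurable_funX.
rewrite /moment unlock; apply: ae_eq_integral => //.
- by apply/measurable_EFinP; apply: measurable_funX.
- apply/measurable_EFinP; apply: measurable_funX.
  exact: measurableT_comp.
- exists N; split => // t /= h; apply: XN => /= X0; apply: h => _ /=.
  by rewrite ger0_norm.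
Qed.

Lemma moment_density d (T : measurableType d) (R : realType)
    (P : probability T R) (X : {RV P >-> R}) (f : R -> R) (k : nat) :
  {ae P, forall t, 0 <= X t} -> has_density X f ->
  moment P X k =
    (\int[lebesgue_measure]_(x in `[0%R, +oo[) (x ^+ k * f x)%:E)%E.
Proof.
move=> X0 [mf f0 fE].
rewrite moment_distribution//.
by rewrite (integral_expr_density (distribution_nneg X0) k mf f0).
Qed.

Lemma integrable_moment_density d (T : measurableType d) (R : realType)
    (P : probability T R) (X : {RV P >-> R}) (f : R -> R) (k : nat) :
  {ae P, forall t, 0 <= X t} -> has_density X f -> (moment P X k < +oo)%E ->
  lebesgue_measure.-integrable (`[0, +oo[%classic : set (measurableTypeR R))
    (fun x : R => (x ^+ k * f x)%:E).
Proof.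
move=> X0 Xf Xmom; have [mf f0 _] := Xf.
apply/integrableP; split.
  apply/measurable_EFinP; apply: measurable_funTS.
  by apply: measurable_funM => //; exact: measurable_funX.
rewrite (_ : integral _ _ _ = moment P X k)//.
rewrite (moment_density k X0 Xf); apply: eq_integral => x.
rewrite inE/= in_itv/= andbT => x0.
by rewrite ger0_norm// mulr_ge0// exprn_ge0.
Qed.

(** The second distribution has density f + g: it is nonnegative because
    |g| <= f, and has the moments of X because all moments of g vanish. *)
Lemma M_indet_of_perturbation d (T : measurableType d) (R : realType)
    (P : probability T R) (X : {RV P >-> R}) (f g : R -> R)
    (A : set (measurableTypeR R)) :
  {ae P, forall t, 0 <= X t} -> (forall k, (moment P X k < +oo)%E) ->
  has_density X f ->
  measurable_fun [set: measurableTypeR R] g -> (forall x, `|g x| <= f x) ->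
  (forall x, x < 0 -> g x = 0) ->
  (forall k,
    \int[lebesgue_measure]_(x in `[0%R, +oo[) (x ^+ k * g x)%:E = 0)%E ->
  measurable A -> (\int[lebesgue_measure]_(x in A) (g x)%:E)%E <> 0%E ->
  M_indet X.
Proof.
move=> X0 Xmom Xf mg gf gneg gmom mA gA.
have [mf f0 fE] := Xf.
pose D : set (measurableTypeR R) := `[0, +oo[%classic.
have mD : measurable D by rewrite /D.
pose w x := f x + g x.
have w0 x : 0 <= w x.
  have := gf x; rewrite ler_norml => /andP[h _].
  by rewrite /w addrC -lerBlDr sub0r.
have mw : measurable_fun [set: measurableTypeR R] w by exact: measurable_funD.
have XD := distribution_nneg X0.
have momE k := moment_density k X0 Xf.
have iXf k := integrable_moment_density X0 Xf (Xmom k).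
have i_f : lebesgue_measure.-integrable setT (EFin \o f).
  apply/integrableP; split; first exact/measurable_EFinP.
  under eq_integral do rewrite gee0_abs ?lee_fin//.
  by rewrite -fE// probability_setT ltry.
have i_g : lebesgue_measure.-integrable setT (EFin \o g).
  apply: le_integrable i_f => //; first exact/measurable_EFinP.
  by move=> x _ /=; rewrite lee_fin (ger0_norm (f0 x)).
have iXg k : lebesgue_measure.-integrable D (fun x => (x ^+ k * g x)%:E).
  apply: le_integrable (iXf k) => //.
    apply/measurable_EFinP; apply: measurable_funTS.
    by apply: measurable_funM => //; exact: measurable_funX.
  move=> x _ /=; rewrite lee_fin !normrM (ger0_norm (f0 x)).
  by rewrite ler_wpM2l.
have wE (E : set (measurableTypeR R)) : measurable E ->
    density_measure lebesgue_measure w E = (distribution P X E +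
      \int[lebesgue_measure]_(x in E) (g x)%:E)%E.
  move=> mE; rewrite fE// /density_measure -integralD//.
  - exact: integrableS i_f.
  - exact: integrableS i_g.
have gT : (\int[lebesgue_measure]_x (g x)%:E = 0)%E.
  rewrite -[RHS](gmom 0) [RHS]integral_mkcond; apply: eq_integral => x _.
  rewrite patchE; case: ifPn; rewrite ?expr0 ?mul1r//.
  rewrite notin_setE/= in_itv/= andbT.
  by move=> /negP; rewrite -ltNge => /gneg ->.
have w1 : (\int[lebesgue_measure]_x (w x)%:E = 1)%E.
  by have := wE _ measurableT; rewrite /density_measure gT adde0 probability_setT.
have [nu nuE] := density_probability mw w0 w1.
have nuD : nu D = 1%E.
  rewrite nuE wE// (XD : distribution P X D = 1%E).
  rewrite -[RHS]adde0 -(gmom 0); congr (_ + _)%E.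
  by apply: eq_integral => x _; rewrite expr0 mul1r.
exists nu; split; first split => // k.
  rewrite integral_expr_norm//.
  rewrite (integral_expr_density nuD k mw w0 (fun A _ => nuE A)).
  rewrite momE -[RHS]adde0 -(gmom k) -integralD//; apply: eq_integral => x _.
  by rewrite /w mulrDr EFinD.
exists A; split => // nuA; apply: gA.
have fin : distribution P X A \is a fin_num.
  by rewrite fE//; apply: integrable_fin_num => //; exact: integrableS i_f.
have := wE _ mA; rewrite -nuE nuA.
move=> /(congr1 (fun z => z - distribution P X A)%E).
by rewrite subee// [(_ + integral _ _ _)%E]addeC addeK.
Qed.

(** * The perturbation and the theorem *)

(** Induction on i through x = (x - c) + c. *)
Lemma shifted_moments0 (R : realType) (c : R) (h : R -> R)
    (I := `[c, +oo[%classic : set (measurableTypeR R)) :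
  (forall i j, lebesgue_measure.-integrable I
     (EFin \o (fun x : R => x ^+ i * ((x - c) ^+ j * h x)))) ->
  (forall j, \int[lebesgue_measure]_(x in I) ((x - c) ^+ j * h x) = 0) ->
  forall i, \int[lebesgue_measure]_(x in I) (x ^+ i * h x) = 0.
Proof.
move=> ih h0 i.
have mI : measurable I by rewrite /I.
suff H j : \int[lebesgue_measure]_(x in I) (x ^+ i * ((x - c) ^+ j * h x)) = 0.
  by rewrite -[RHS](H 0%N); apply: eq_Rintegral => x _; rewrite expr0 mul1r.
elim: i j => [|i IH] j.
  by rewrite -[RHS](h0 j); apply: eq_Rintegral => x _; rewrite expr0 mul1r.
transitivity (\int[lebesgue_measure]_(x in I)
    (x ^+ i * ((x - c) ^+ j.+1 * h x) + c * (x ^+ i * ((x - c) ^+ j * h x)))).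
  by apply: eq_Rintegral => x _; rewrite !exprS; ring.
rewrite RintegralD//.
  by rewrite RintegralZl// !IH mulr0 addr0.
by have := integrableZl mI c (ih i j).
Qed.

Lemma powR_shift_le (R : realType) (al c x : R) : 0 < al -> 0 <= c -> c <= x ->
  x `^ al <= 2 `^ al * ((x - c) `^ al + c `^ al).
Proof.
move=> al0 c0 cx; have xc0 : 0 <= x - c by rewrite subr_ge0.
have x0 : 0 <= x := le_trans c0 cx.
have [h|h] := leP c (x - c).
  apply: (@le_trans _ _ ((2 * (x - c)) `^ al)).
    apply: ge0_ler_powR; rewrite ?nnegrE ?mulr_ge0 ?(ltW al0)//.
    by lra.
  by rewrite powRM// ler_wpM2l ?powR_ge0// lerDl powR_ge0.
apply: (@le_trans _ _ ((2 * c) `^ al)).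
  apply: ge0_ler_powR; rewrite ?nnegrE ?mulr_ge0 ?(ltW al0)//.
  by lra.
by rewrite powRM// ler_wpM2l ?powR_ge0// lerDr powR_ge0.
Qed.

(** The perturbation is a small multiple of the damped sine started at c, so
    that nothing is asked of f below c. Its integrability against powers of x
    comes from the finite moments of f, which dominates it. *)
Lemma M_indet_of_lower_bound d (T : measurableType d) (R : realType)
    (P : probability T R) (X : {RV P >-> R}) (f : R -> R) (al b k c : R) :
  {ae P, forall t, 0 <= X t} -> (forall k, (moment P X k < +oo)%E) ->
  has_density X f ->
  0 < al -> al < 2^-1 -> 0 < k -> 0 < c ->
  (forall x, c <= x -> k * expR (- (x `^ al * b)) <= f x) ->
  M_indet X.
Proof.
move=> X0 Xmom Xf al0 al2 k0 c0 fb.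
have [mf f0 fE] := Xf.
have alpi : 0 < al * pi < pi / 2.
  by rewrite mulr_gt0 ?pi_gt0//= mulrC ltr_pM2l ?pi_gt0.
have cos0 : 0 < cos (al * pi).
  have /andP[? ?] := alpi; apply: cos_gt0_pihalf; apply/andP; split=> //.
  by rewrite (@lt_trans _ _ 0)// oppr_lt0 divr_gt0 ?pi_gt0.
have sin0 : 0 < sin (al * pi) by exact: sin_gt0_pihalf.
(* The decay rate gam and the factor K are what powR_shift_le requires for
   K * expR (- gam (x - c)^al) to stay below k * expR (- b x^al); adding 1
   makes gam positive. *)
pose gam := 2 `^ al * `|b| + 1.
have gam0 : 0 < gam by rewrite ltr_wpDl ?mulr_ge0 ?powR_ge0.
pose a := gam / cos (al * pi).
have a0 : 0 < a by rewrite divr_gt0.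
have acos : a * cos (al * pi) = gam by rewrite /a divfK// gt_eqF.
pose sig := a * sin (al * pi).
have sig0 : 0 < sig by rewrite mulr_gt0.
pose K := k * expR (- (2 `^ al * `|b| * c `^ al)).
have K0 : 0 < K by rewrite mulr_gt0 ?expR_gt0.
pose u (x : R) := (x - c) `^ al.
pose h (x : R) := expR (- (u x * gam)) * sin (u x * sig).
have hf x : c <= x -> `|K * h x| <= f x.
  move=> cx; apply: le_trans (fb x cx).
  rewrite normrM (gtr0_norm K0) /h normrM ger0_norm ?expR_ge0//.
  apply: (@le_trans _ _ (K * expR (- (u x * gam)))).
    by rewrite ler_pM2l// ler_piMr ?expR_ge0// sin_max.
  rewrite /K -mulrA -expRD ler_pM2l// ler_expR -opprD lerN2.
  apply: (@le_trans _ _ (x `^ al * `|b|)).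
    by rewrite ler_wpM2l ?powR_ge0// ler_norm.
  have := ler_wpM2r (normr_ge0 b) (powR_shift_le al0 (ltW c0) cx).
  move=> /le_trans; apply; rewrite -/(u x) /gam.
  have : 0 <= u x by exact: powR_ge0.
  by nra.
have mu : measurable_fun [set: measurableTypeR R] u.
  apply: (@measurableT_comp _ _ _ _ _ _ (fun x : R => x `^ al)).
    exact: measurable_powR.
  exact: measurable_funB.
have mh : measurable_fun [set: measurableTypeR R] h.
  apply: measurable_funM.
    apply: measurableT_comp => //; apply: measurableT_comp => //.
    exact: measurable_funM.
  apply: measurableT_comp; last exact: measurable_funM.
  apply: continuous_measurable_fun; exact: continuous_sin.
pose I : set (measurableTypeR R) := `[c, +oo[%classic.
have mI : measurable I by rewrite /I.
pose g : R -> R := (fun x => K * h x) \_ I.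
have mg : measurable_fun [set: measurableTypeR R] g.
  apply/(measurable_restrict _ _ _).1 => //; rewrite setTI.
  by apply: measurable_funTS; exact: measurable_funM.
have ge x : c <= x -> g x = K * h x.
  by move=> cx; rewrite /g patchE mem_set// /I/= in_itv/= cx.
have gl x : x < c -> g x = 0.
  by move=> xc; rewrite /g patchE memNset// /I/= in_itv/= andbT leNgt xc.
have gf x : `|g x| <= f x.
  have [cx|xc] := leP c x; first by rewrite ge// hf.
  by rewrite gl// normr0.
(* On ]c, c + eta[ the argument of the sine stays in ]0, pi[. *)
pose eta := (pi / sig) `^ al^-1.
have eta0 : 0 < eta by rewrite powR_gt0// divr_gt0 ?pi_gt0.
pose A : set (measurableTypeR R) := `]c, (c + eta)[%classic.
have mA : measurable A by rewrite /A.
apply: (M_indet_of_perturbation (g := g) (A := A) X0 Xmom Xf) => //.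
- by move=> x x0; apply: gl; exact: lt_trans c0.
- move=> n.
  have ih i j : lebesgue_measure.-integrable I
     (EFin \o (fun x : R => x ^+ i * ((x - c) ^+ j * (K * h x)))).
    have ID : I `<=` `[0, +oo[.
      by move=> x; rewrite /I /= !in_itv/= !andbT; exact: le_trans (ltW c0).
    have := integrableS _ mI ID
      (integrable_moment_density X0 Xf (Xmom (i + j)%N)).
    move=> /(_ _)/le_integrable; apply => //.
      apply/measurable_EFinP; apply: measurable_funTS.
      apply: measurable_funM; first exact: measurable_funX.
      apply: measurable_funM; last exact: measurable_funM.
      by apply: measurable_funX; exact: measurable_funB.
    move=> x; rewrite /I/= in_itv/= andbT => cx.
    have xc0 : 0 <= x - c by rewrite subr_ge0.
    have x0 : 0 <= x := le_trans (ltW c0) cx.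
    rewrite /= lee_fin normrM (ger0_norm (exprn_ge0 i x0)).
    rewrite normrM (ger0_norm (exprn_ge0 j xc0)).
    rewrite (ger0_norm (mulr_ge0 (exprn_ge0 (i + j) x0) (f0 x))) exprD -mulrA.
    rewrite ler_wpM2l ?exprn_ge0// ler_pM ?exprn_ge0 ?hf//.
    by rewrite lerXn2r// lerBlDr lerDl ltW.
  have h0 j : \int[lebesgue_measure]_(x in I) ((x - c) ^+ j * (K * h x)) = 0.
    have ihj : lebesgue_measure.-integrable I
        (fun x : R => ((x - c) ^+ j * h x)%:E).
      have := integrableZl mI K^-1 (ih 0%N j); apply: eq_integrable => // x _ /=.
      by rewrite -EFinM expr0 mul1r; congr EFin; field; rewrite gt_eqF.
    have := @stieltjes_moments0 R al a c j al0 al2 a0.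
    rewrite acos -/sig => /(_ ihj) hj.
    transitivity (K * \int[lebesgue_measure]_(x in I) ((x - c) ^+ j * h x)).
      by rewrite -RintegralZl//; apply: eq_Rintegral => x _; rewrite mulrCA.
    by rewrite [X in K * X]hj mulr0.
  have sm := shifted_moments0 ih h0 n.
  transitivity (\int[lebesgue_measure]_(x in I) (x ^+ n * (K * h x))%:E)%E.
    rewrite [LHS]integral_mkcond [RHS]integral_mkcond; apply: eq_integral => x _.
    rewrite !patchE /I !mem_setE !in_itv/= !andbT.
    have [cx|xc] := leP c x.
      by rewrite (le_trans (ltW c0) cx) ge.
    by rewrite gl// mulr0; case: ifP.
  rewrite -[LHS]fineK; last first.
    apply: integrable_fin_num => //.
    by have := ih n 0%N; apply: eq_integrable => // x _ /=; rewrite expr0 mul1r.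
  exact: (congr1 EFin sm).
- have gpos x : A x -> 0 < g x.
    rewrite /A/= in_itv/= => /andP[cx xe].
    rewrite ge ?(ltW cx)// mulr_gt0// mulr_gt0 ?expR_gt0//.
    have xc0 : 0 < x - c by rewrite subr_gt0.
    apply: sin_gt0_pi; rewrite mulr_gt0 ?powR_gt0//= -ltr_pdivlMr//.
    have -> : pi / sig = eta `^ al.
      by rewrite /eta -powRrM mulVf ?gt_eqF// powRr1// ltW// divr_gt0 ?pi_gt0.
    by apply: gt0_ltr_powR; rewrite ?nnegrE ?(ltW eta0) ?(ltW xc0)// ltrBlDl.
  move=> gA0.
  have : (\int[lebesgue_measure]_(x in A) `|(g x)%:E| = 0)%E.
    rewrite -[RHS]gA0; apply: eq_integral => x /set_mem Ax.
    by rewrite gee0_abs// lee_fin ltW// gpos.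
  have mgA : measurable_fun A (fun x : R => (g x)%:E).
    by apply/measurable_EFinP; exact: measurable_funTS.
  move=> /(ae_eq_integral_abs _ mA mgA).1 [N [mN N0 AN]].
  have : lebesgue_measure A = 0%E.
    apply: (subset_measure0 mA mN _ N0) => x Ax; apply: AN => /= /(_ Ax) [gx0].
    by have := gpos x Ax; rewrite gx0 ltxx.
  rewrite /A lebesgue_measure_itv/= lte_fin ltrDl eta0 => -[].
  by rewrite addrAC subrr add0r => /eqP; rewrite gt_eqF.
Qed.

Theorem theorem4 (R : realType) (d : measure_display) (T : measurableType d)
    (P : probability T R) (X : {RV P >-> R}) (C eps : R) (f : R -> R) (x0 : R)
    (X_ge0 : {ae P, forall t, 0 <= X t})
    (X_moments : forall k : nat, (moment P X k < +oo)%E)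
    (C_gt0 : 0 < C) (eps_gt0 : 0 < eps)
    (growth : \forall k \near \oo,
       C * k.+1%:R `^ (2 + eps) <=
       fine (moment P X k.+1) / fine (moment P X k))
    (X_density : has_density X f)
    (x0_gt0 : 0 < x0)
    (f_gt0 : forall x, x0 <= x -> 0 < f x)
    (f_derivable : derivable_cy f x0)
    (L_incr : forall x y, x0 < x -> x <= y -> L_ f x <= L_ f y)
    (L_cvg : L_ f x @[x --> +oo] --> +oo) :
  M_indet X.
Proof.
have [mf f0 _] := X_density; have [_ df] := f_derivable.
have momE k := moment_density k X_ge0 X_density.
have e2 : 0 < 2 + eps by rewrite addr_gt0.
have [||B [x1 [x01 LB]]] :=
  elasticity_le_powR C_gt0 eps_gt0 x0_gt0 mf f0 f_gt0 df L_incr L_cvg.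
- move=> k; apply: integrable_fin_num => //.
  exact: integrable_moment_density X_ge0 X_density (X_moments k).
- by apply: filterS growth => k; rewrite !momE.
have al0 : 0 < (2 + eps)^-1 by rewrite invr_gt0.
have [k k0 fk] := density_lower_bound x0_gt0 f_gt0 df x01 al0 LB.
apply: (M_indet_of_lower_bound X_ge0 X_moments X_density al0 _ k0 _ fk).
- by rewrite ltf_pV2 ?posrE// ltrDl.
- exact: lt_trans x01.
Qed.
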